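(* Let $0<\delta<1$ and let $u\in C([-1-\delta,0])\cap C^2([0,1])$, in the sense that $u:[-1-\delta,1]\to\mathbb{R}$ is continuous on $[-1-\delta,0]$ and $u|_{(0,1]}$ extends to a $C^2$ function on $[0,1]$ (so $u$ may have a jump discontinuity at $0$). If $-\mathcal{L}^{\rm qnl}_\delta u(x)\le 0$ for all $x\in\Omega$, then $$\max_{x\in\Omega\cup\Omega_\delta}u(x)\le\max_{x\in\Omega_\delta}u(x),$$ where each maximum is understood as a supremum.
   Context: $\Omega=(-1,1)$ and $\Omega_\delta=(-1-\delta,-1)\cup\{1\}$. The kernel is $\gamma_\delta(s)=\gamma_\delta(|s|)=\delta^{-3}\gamma(|s|/\delta)$ for $s\in\mathbb{R}$, where $\gamma\ge 0$ is nonincreasing on $(0,1)$, is supported in $[0,1]$ (i.e. $\gamma(r)=0$ for $r>1$), and satisfies $\int_{\mathbb{R}}|s|^2\gamma(|s|)\,ds=1$. The weight is $\omega_\delta(x)=\int_0^1 dt\int_{|s|<x/t}|s|^2\gamma_\delta(|s|)\,ds$ for $x>0$ (so $\omega_\delta=1$ on $[\delta,\infty)$). The quasinonlocal operator is $$\mathcal{L}^{\rm qnl}_\delta u(x)=\begin{cases}2\int_{\mathbb{R}}\gamma_\delta(|y-x|)(u(y)-u(x))\,dy, & x\le 0,\\ 2\int_{y<0}\gamma_\delta(|y-x|)(u(y)-u(x))\,dy+(\omega_\delta u')'(x), & 0<x\le\delta,\\ u''(x), & x>\delta,\end{cases}$$ where for $x\in\Omega$ only values of $u$ on $[-1-\delta,1]$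 enter, and the integral for $x\le 0$ is taken in the principal value sense if it is not absolutely convergent. *)

(* Defs.v *)
From mathcomp Require Import all_boot all_order all_algebra.
From mathcomp Require Import all_classical all_reals all_analysis.

Set Implicit Arguments.
Unset Strict Implicit.
Unset Printing Implicit Defensive.

Import Order.TTheory GRing.Theory Num.Theory.
Import numFieldNormedType.Exports.

Local Open Scope classical_set_scope.
Local Open Scope ring_scope.

(* Functions are total on R. A function u with natural domain [-1-δ, 1] is any
   total extension: for x in (-1, 1) the operator below only sees u on
   [-1-δ, 1], because the kernel vanishes at distances larger than δ < 1. *)

Definition Omega {R : realType} : set R := `]-1, 1[%classic.

Definition Omega_delta {R : realType} (delta : R) : set R :=
  `]-1 - delta, -1[%classic `|` [set 1].

(* At an endpoint of A, a one-sided derivative. *)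
Definition is_derivative_on {R : realType} (A : set R) (f g : R -> R) : Prop :=
  forall x, A x -> (f y - f x) / (y - x) @[y --> within A (x^')] --> g x.

Definition C2_on {R : realType} (A : set R) (f : R -> R) : Prop :=
  exists f' f'' : R -> R,
    [/\ is_derivative_on A f f', is_derivative_on A f' f''
      & {within A, continuous f''}].

Definition scaled_kernel {R : realType} (delta : R) (gamma : R -> R) (s : R) : R :=
  delta ^- 3 * gamma (`|s| / delta).

(* [fine] loses nothing: both integrals are finite as soon as |s|^2 gamma(|s|)
   is integrable. *)
Definition weight {R : realType} (delta : R) (gamma : R -> R) (x : R) : R :=
  fine (\int[lebesgue_measure]_(t in `]0%R, 1%R[)
          \int[lebesgue_measure]_(s in [set s : R | (`|s| < x / t)%R])
            (`|s| ^+ 2 * scaled_kernel delta gamma s)%:E)%E.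

Definition truncated_integral {R : realType} (f : R -> R) (x eps : R) : \bar R :=
  (\int[lebesgue_measure]_(y in [set y : R | (eps < `|y - x|)%R]) (f y)%:E)%E.

(* The integral of f over R if it converges absolutely, and otherwise its
   principal value at x, which may be infinite. *)
Definition pv_integral {R : realType} (f : R -> R) (x : R) : \bar R :=
  if `[< (@lebesgue_measure R).-integrable setT (EFin \o f) >]
  then (\int[lebesgue_measure]_y (f y)%:E)%E
  else lim (truncated_integral f x eps @[eps --> 0^'+]).

(* [cvg] is taken in \bar R: divergence to +oo or -oo counts as existence.
   Otherwise, the [lim] in [pv_integral] is a meaningless default value. *)
Definition pv_exists {R : realType} (f : R -> R) (x : R) : Prop :=
  (@lebesgue_measure R).-integrable setT (EFin \o f) \/
  cvg (truncated_integral f x eps @[eps --> 0^'+]).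

Definition jump_integrand {R : realType} (delta : R) (gamma u : R -> R)
    (x y : R) : R :=
  scaled_kernel delta gamma `|y - x| * (u y - u x).

Definition Lqnl {R : realType} (delta : R) (gamma u : R -> R) (x : R) : \bar R :=
  if x <= 0 then
    (2%:E * pv_integral (jump_integrand delta gamma u x) x)%E
  else if x <= delta then
    (2%:E * \int[lebesgue_measure]_(y in `]-oo, 0%R[)
              (jump_integrand delta gamma u x y)%:E
     + (derive1 (fun z : R => weight delta gamma z * derive1 u z)%R x)%:E)%E
  else (derive1n 2 u x)%:E.

(* For x > 0 and u of class C^2 on (0, 1], both the integral (over
   |y - x| > x) and the derivatives exist, so only x <= 0 needs a condition. *)
Definition Lqnl_defined {R : realType} (delta : R) (gamma u : R -> R) (x : R)
    : Prop :=
  x <= 0 -> pv_exists (jump_integrand delta gamma u x) x.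

(* Main.v *)
Require Import Defs.
From mathcomp Require Import all_boot all_order all_algebra.
From mathcomp Require Import all_classical all_reals all_analysis.
From mathcomp Require Import measurable_realfun lra ring.

Import Order.TTheory GRing.Theory Num.Theory.
Import numFieldNormedType.Exports.

Local Open Scope classical_set_scope.
Local Open Scope ring_scope.

(** Let [M] be the supremum of [u] over [-1 - delta, 1], the right branch being
    read on [0, 1] through its [C^2] extension [v]; the point [0] counts for
    both branches, so that the jump is harmless. There are two cases.

    If [M] is attained by [u] on [-1 - delta, 0], let [m] be the first point
    where this happens. Were [m > -1], the nonlocal equation at [m] would have a
    nonpositive integrand, since [u <= u m] within distance [delta], and this
    integrand would be bounded away from [0] on an interval just to the left of
    [m], because the kernel is positive near the origin and [u < u m] there. The
    integral would be negative, in the absolutely convergent as well as in the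
    principal value sense ([pv_integral_first_max_lt0]). So [m <= -1], and [M] is
    the value of [u] on the closed collar, hence at most the supremum over the open
    one ([ereal_sup_ge_closure]).

    Otherwise [v] attains [M] on [0, 1], strictly above all values of [u] on the
    left; let [m] be the last point where it does, and suppose [m < 1]. Just to
    the right of [m], [u] still exceeds its values on the left, so the integral
    term is nonpositive and the equation makes the flux [w u'] nondecreasing
    ([flux_derive_ge0]); past [delta] it makes [u'] itself nondecreasing. The flux
    starts from a nonnegative value: if [m > 0] then [u' m = 0], and if [m = 0]
    then [w] tends to [0] while [u'] stays bounded ([flux_ge0_at0]). As [w > 0],
    [u' >= 0] to the right of [m] ([derivative_ge0_after_max]), which contradicts
    the choice of [m]. So [m = 1], a point of the constraint set.

    This uses three facts on the weight: positivity on [x > 0], the limit [0] at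
    the origin and differentiability on [(0, delta)]. By Tonelli,
    [w x = \int kappa(s) |s| min(|s|, x) ds]
    ([weight_fubini]), where [kappa] is the scaled kernel, and all three
    can be read off this formula. *)

(** * Maximum points and one-sided derivatives *)

Section calculus.
Set Implicit Arguments. Unset Strict Implicit. Unset Printing Implicit Defensive.
Context {R : realType}.
Implicit Types (f g : R -> R) (a b x : R).

Lemma compact_argmax f a b (M : R) : {within `[a, b], continuous f} ->
  compact (`[a, b]%classic `&` f @^-1` [set M]).
Proof.
move=> cf; apply: (@subclosed_compact _ _ `[a, b]%classic).
- rewrite closed_setSI; last exact: interval_closed.
  by move/continuous_closedP : cf; apply; exact: closed_eq.
- exact: segment_compact.
- exact: subIsetl.
Qed.

(** The first maximum point is the minimum of the compact set of all maximum
    points. *)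
Lemma first_argmax f a b : a <= b -> {within `[a, b], continuous f} ->
  exists2 c, c \in `[a, b] & (forall x, x \in `[a, b] -> f x <= f c) /\
                             (forall x, x \in `[a, b] -> x < c -> f x < f c).
Proof.
move=> ab cf; have [m mab fm] := EVT_max ab cf.
have A0 : `[a, b]%classic `&` f @^-1` [set f m] !=set0 by exists m.
have cid : {within `[a, b]%classic `&` f @^-1` [set f m], continuous (@id R)}.
  by apply: continuous_subspaceT => x; exact: cvg_id.
have [c] := compact_EVT_min A0 (@compact_argmax f a b (f m) cf) cid.
rewrite inE => -[/= cab fcm] cmin; exists c => //; split=> x xab.
  by rewrite fcm; exact: fm.
rewrite ltNge fcm lt_neqAle fm// andbT; apply: contra => /eqP fxm.
by apply: cmin; rewrite inE; split.
Qed.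

Lemma last_argmax f a b : a <= b -> {within `[a, b], continuous f} ->
  exists2 c, c \in `[a, b] & (forall x, x \in `[a, b] -> f x <= f c) /\
                             (forall x, x \in `[a, b] -> c < x -> f x < f c).
Proof.
move=> ab cf; have [m mab fm] := EVT_max ab cf.
have A0 : `[a, b]%classic `&` f @^-1` [set f m] !=set0 by exists m.
have cid : {within `[a, b]%classic `&` f @^-1` [set f m], continuous (@id R)}.
  by apply: continuous_subspaceT => x; exact: cvg_id.
have [c] := compact_EVT_max A0 (@compact_argmax f a b (f m) cf) cid.
rewrite inE => -[/= cab fcm] cmax; exists c => //; split=> x xab.
  by rewrite fcm; exact: fm.
rewrite ltNge fcm lt_neqAle fm// andbT; apply: contra => /eqP fxm.
by apply: cmax; rewrite inE; split.
Qed.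

(** Continuity on a segment in epsilon-delta form, one-sided at the endpoints. *)
Lemma within_continuousP f a b x : {within `[a, b], continuous f} ->
  x \in `[a, b] -> forall e, 0 < e ->
  exists2 d, 0 < d & forall y, y \in `[a, b] -> `|x - y| < d -> `|f x - f y| < e.
Proof.
move=> /subspace_continuousP cf xab e e0.
have /cvgrPdist_lt/(_ e e0) := cf x xab.
rewrite near_withinE => -[d /= d0 fd]; exists d => // y yab xy.
exact: fd.
Qed.

(** A set that contains the open interval controls the values at its endpoints
    too. Continuity is only assumed within [a, b], so the nearby point has to be
    taken inside, on the side of [x] where there is room. *)
Lemma ereal_sup_ge_closure (u : R -> R) (A : set R) a b c d x :
  c < d -> {within `[a, b], continuous u} -> `]c, d[ `<=` A ->
  `[c, d] `<=` `[a, b] -> x \in `[c, d] ->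
  ((u x)%:E <= ereal_sup [set (u y)%:E | y in A])%E.
Proof.
move=> cd cu sA sab xcd; apply/lee_addgt0Pr => e e0.
have [r r0 ur] := within_continuousP cu (sab _ xcd) e0.
move: xcd; rewrite in_itv/= => /andP[cx xd].
have [y [ycd yr]] : exists y, (y \in `]c, d[) /\ (`|x - y| < r).
  have [xm|mx] := ltrP x ((c + d) / 2).
    exists (Num.min (x + r / 2) ((c + d) / 2)).
    have xy : x < Num.min (x + r / 2) ((c + d) / 2) by rewrite lt_min xm; lra.
    have yr : Num.min (x + r / 2) ((c + d) / 2) <= x + r / 2 by rewrite ge_min lexx.
    have yd : Num.min (x + r / 2) ((c + d) / 2) <= (c + d) / 2.
      by rewrite ge_min lexx orbT.
    split; first by rewrite in_itv/=; apply/andP; split; lra.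
    by rewrite ltr0_norm ?subr_lt0//; lra.
  exists (Num.max (x - r / 2) ((c + x) / 2)).
  have yx : Num.max (x - r / 2) ((c + x) / 2) < x.
    by rewrite gt_max; apply/andP; split; lra.
  have yr : x - r / 2 <= Num.max (x - r / 2) ((c + x) / 2) by rewrite le_max lexx.
  have yc : (c + x) / 2 <= Num.max (x - r / 2) ((c + x) / 2).
    by rewrite le_max lexx orbT.
  split; first by rewrite in_itv/=; apply/andP; split; lra.
  by rewrite gtr0_norm ?subr_gt0//; lra.
have uy : ((u y)%:E <= ereal_sup [set (u y)%:E | y in A])%E.
  by apply: ereal_sup_ubound; exists y => //; exact: sA.
apply: (@le_trans _ _ ((u y)%:E + e%:E)%E); last exact: leeD2r.
rewrite -EFinD lee_fin -lerBlDl; apply: ltW.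
have yab : y \in `[a, b] by apply: sab; exact: subset_itv_oo_cc ycd.
by have /ltr_normlW := ur y yab yr.
Qed.

Lemma is_derivative_on_near (A : set R) f g x : is_derivative_on A f g ->
  A x -> forall e, 0 < e ->
  exists2 d, 0 < d & forall y, A y -> y != x -> `|x - y| < d ->
    `|g x - (f y - f x) / (y - x)| < e.
Proof.
move=> fg Ax e e0; have /cvgrPdist_lt/(_ e e0) := fg x Ax.
rewrite near_withinE near_withinE => -[d /= d0 fd]; exists d => // y yA yx xy.
by apply: fd.
Qed.

Lemma is_derivative_on_continuous (A : set R) f g : is_derivative_on A f g ->
  {within A, continuous f}.
Proof.
move=> fg; apply/subspace_continuousP => x Ax.
apply/cvgrPdist_lt => e e0; rewrite near_withinE.
have [d d0 fd] := @is_derivative_on_near A f g x fg Ax 1 ltr01.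
have k0 : 0 < 1 + `|g x| by rewrite ltr_pwDl.
exists (Num.min d (e / (1 + `|g x|))) => /=.
  by rewrite lt_min d0/= divr_gt0.
move=> y /=; rewrite lt_min => /andP[xyd xye] Ay.
have [->|yx] := eqVneq y x; first by rewrite subrr normr0.
have yx0 : y - x != 0 by rewrite subr_eq0.
have {}fd := fd _ Ay yx xyd.
have fyx : `|f x - f y| = `|(f y - f x) / (y - x)| * `|x - y|.
  by rewrite (distrC x y) -normrM divfK// distrC.
rewrite fyx; apply: (@le_lt_trans _ _ ((1 + `|g x|) * `|x - y|)); last first.
  by rewrite mulrC -ltr_pdivlMr.
apply: ler_wpM2r => //; rewrite -[X in `|X|](subrK (g x)).
apply: (le_trans (ler_normD _ _)); rewrite lerD2r distrC; exact: ltW.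
Qed.

(** At interior points the one-sided notion is the usual derivative. *)
Lemma is_derivative_on_is_derive (A : set R) f g x : is_derivative_on A f g ->
  (\forall y \near x, A y) -> is_derive x 1 f (g x).
Proof.
move=> fg [r /= r0 rA].
have Ax : A x by apply: rA; rewrite /ball_/= subrr normr0.
have fgx : h^-1 *: (f (h *: 1 + x) - f x) @[h --> 0^'] --> g x.
  apply/cvgrPdist_lt => e e0.
  have [d d0 fd] := @is_derivative_on_near A f g x fg Ax e e0.
  rewrite near_withinE; exists (Num.min r d) => /=; first by rewrite lt_min r0.
  move=> h /=; rewrite sub0r normrN lt_min => /andP[hr hd] h0.
  have yxE : (h *: 1 + x : R) - x = h by rewrite addrK /GRing.scale/= mulr1.
  have xyE : `|x - (h *: 1 + x)| = `|h| by rewrite distrC yxE.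
  have := fd (h *: 1 + x); rewrite yxE xyE mulrC; apply => //.
    by apply: rA; rewrite /ball_/= xyE.
  by rewrite -subr_eq0 yxE.
apply: DeriveDef; last exact: cvg_lim.
exact/cvgP/fgx.
Qed.

(** Passes from the [C^2] extension [v] to [u] itself, the function that enters
    the operator: the two agree near each point of the open interval. *)
Lemma C2_on_interior (u v v' v'' : R -> R) :
  is_derivative_on `[0, 1] v v' -> is_derivative_on `[0, 1] v' v'' ->
  (forall x : R, 0 < x -> x <= 1 -> u x = v x) ->
  forall x : R, x \in `]0, 1[ ->
  [/\ derivable v x 1, derive1 v x = v' x, derive1 u x = v' x
    & derivable (derive1 u) x 1].
Proof.
move=> dv dv' uv.
have A01 (x : R) : x \in `]0, 1[ -> \forall y \near x, `[0, 1]%classic y.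
  move=> /near_in_itvoo; apply: filterS => y; rewrite !in_itv/= => /andP[y0 y1].
  by apply/andP; split; exact: ltW.
have vE (x : R) : x \in `]0, 1[ -> is_derive x 1 v (v' x).
  by move=> x01; apply: is_derivative_on_is_derive dv _; exact: A01.
have uE (x : R) : x \in `]0, 1[ -> derive1 u x = v' x.
  move=> x01; rewrite derive1E (near_eq_derive _ (g := v)).
    by case: (vE _ x01).
  move: x01 => /near_in_itvoo; apply: filterS => y.
  by rewrite in_itv/= => /andP[y0 /ltW y1]; exact: uv.
move=> x x01; split; [|by rewrite derive1E; case: (vE _ x01)|exact: uE|].
  by case: (vE _ x01).
apply: (near_eq_derivable (f := v')).
  by move: x01 => /near_in_itvoo; apply: filterS => y /uE.
by case: (is_derivative_on_is_derive dv' (A01 _ x01)).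
Qed.

(** Stated on the open interval because the flux [w u'] will be considered on an
    interval starting at [0], where [u] may jump. *)
Lemma derive1_ge0_homo (F : R -> R) a b :
  (forall x : R, x \in `]a, b[ -> derivable F x 1) ->
  (forall x : R, x \in `]a, b[ -> 0 <= derive1 F x) ->
  forall x y, a < x -> x <= y -> y < b -> F x <= F y.
Proof.
move=> dF F0 x y ax xy yb.
have sub (z : R) : z \in `[x, y] -> z \in `]a, b[.
  by rewrite !in_itv/= => /andP[xz zy]; rewrite (lt_le_trans ax)//= (le_lt_trans zy).
have subo (z : R) : z \in `]x, y[ -> z \in `]a, b[.
  by move=> zxy; apply: sub; exact: subset_itv_oo_cc.
apply: (@ger0_derive1_ndecr _ F x y) => //.
- by move=> z /subo /dF.
- by move=> z /subo /F0.
- by apply: derivable_within_continuous => z /sub /dF.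
Qed.

Lemma ge0_after (F : R -> R) m b :
  (forall x : R, x \in `[m, b[ -> derivable F x 1) ->
  (forall x : R, x \in `]m, b[ -> 0 <= derive1 F x) ->
  0 <= F m -> forall x : R, x \in `]m, b[ -> 0 <= F x.
Proof.
move=> dF F0 Fm x; rewrite in_itv/= => /andP[mx xb]; apply: (le_trans Fm).
apply: (@ger0_derive1_ndecr _ F m x) => //; last exact: ltW.
- move=> z; rewrite in_itv/= => /andP[mz zx]; apply: dF.
  by rewrite in_itv/= (ltW mz)/= (lt_trans zx).
- move=> z; rewrite in_itv/= => /andP[mz zx]; apply: F0.
  by rewrite in_itv/= mz/= (lt_trans zx).
- apply: derivable_within_continuous => z; rewrite in_itv/= => /andP[mz zx].
  by apply: dF; rewrite in_itv/= mz (le_lt_trans zx).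
Qed.

(** The map [x |-> min a x] has slope [1] before [a] and [0] after it, so its
    linearization is exact unless the kink [a] lies between [x - |h|] and
    [x + |h|]. *)
Lemma min_increment (a x h : R) :
  `|Num.min a (x + h) - Num.min a x - h * (x < a)%R%:R|
    <= `|h| * (`|a - x| <= `|h|)%R%:R.
Proof.
have hh : `|h| = h \/ `|h| = - h.
  by case: (leP 0 h) => h0; [left; rewrite ger0_norm|right; rewrite ltr0_norm].
have h0 := normr_ge0 h; have [ax|ax] := leP `|a - x| `|h|.
  rewrite mulr1; move: ax; rewrite !ler_norml => /andP[ax1 ax2].
  by case: (ltrP x a) => xa; case: (leP a (x + h)) => xha; rewrite ?mulr1 ?mulr0;
    case: hh => hh; apply/andP; split; lra.
rewrite mulr0 normr_le0; apply/eqP.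
move: ax; case: (ltrP x a) => xa; case: (leP a (x + h)) => xha; rewrite ?mulr1 ?mulr0.
all: case: hh => hh; rewrite ?(ger0_norm (x := a - x)) ?(ler0_norm (x := a - x)).
all: lra.
Qed.

End calculus.

(** * Integrals of nonpositive functions *)

Section nonpositive_integral.
Set Implicit Arguments. Unset Strict Implicit. Unset Printing Implicit Defensive.
Context {R : realType}.
Local Notation mu := (@lebesgue_measure R).
Import HBNNSimple.

(** The integral of a nonnegative function, measurable or not, is the supremum
    over all simple functions below it. This level of generality is what fits
    [u], which is arbitrary outside [-1 - delta, 1]. *)
Lemma nnsfun_le_integral (f : R -> \bar R) (h : {nnsfun (measurableTypeR R) >-> R}) :
  (forall x, (0 <= f x)%E) -> (forall x, ((h x)%:E <= f x)%E) ->
  (\int[mu]_x (h x)%:E <= \int[mu]_x f x)%E.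
Proof.
move=> f0 hf; rewrite (integralT_nnsfun mu h) ge0_integralTE//.
by apply: ereal_sup_ubound; exists h.
Qed.

(** A quantitative form of the fact that a nonpositive function has a negative
    integral as soon as it is negative somewhere; the uniform bound is what
    survives the limit in a principal value. *)
Lemma integral_le_neg (D : set R) (f : R -> R) (p q c : R) :
  0 <= c -> p <= q -> (forall x, D x -> f x <= 0) -> `[p, q] `<=` D ->
  (forall x, x \in `[p, q] -> f x <= - c) ->
  (\int[mu]_(x in D) (f x)%:E <= (- (c * (q - p)))%:E)%E.
Proof.
move=> c0 pq fD pqD fc; rewrite integralE integral0_eq ?add0e; last first.
  by move=> x Dx; rewrite (@le0_funeposE _ _ D) ?inE// => y Dy; rewrite lee_fin fD.
rewrite EFinN leeN2.
pose h := scale_nnsfun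
  (@indic_nnsfun _ (measurableTypeR R) R _ (measurable_itv `[p, q])) c0.
have <- : (\int[mu]_x (h x)%:E = (c * (q - p))%:E)%E.
  rewrite /h/= (@integralZl_indic _ (measurableTypeR R) R mu setT measurableT
    (fun=> [set` `[p, q]%R]) c)//; last first.
    by move=> /lt_geF; rewrite c0.
  rewrite integral_indic// setIT [X in (_ * X)%E](lebesgue_measure_itv `[p, q]%R)/= lte_fin.
  rewrite lt_neqAle pq andbT; case: eqVneq => [->|_] /=.
    by rewrite subrr mulr0 mule0.
  by rewrite EFinM EFinB.
rewrite [leRHS]integral_mkcond; apply: nnsfun_le_integral => x.
  exact: erestrict_ge0.
rewrite /h/= mindicE patchE.
have [xpq|xpq] := boolP (x \in [set` `[p, q]%R]); rewrite ?mulr1 ?mulr0; last first.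
  by case: ifP => // _; rewrite funenegE le_max lexx orbT.
have xD : x \in D by rewrite inE; apply: pqD; move: xpq; rewrite inE.
have fD' y : D y -> ((f y)%:E <= 0)%E by move=> Dy; rewrite lee_fin fD.
rewrite xD (le0_funenegE fD' xD).
rewrite -EFinN lee_fin lerNr fc//.
by move: xpq; rewrite inE.
Qed.

(** Small truncations do not reach the interval [p, q], so the truncated
    integrals satisfy the bound of [integral_le_neg] uniformly. *)
Lemma pv_integral_le_neg (f : R -> R) (x p q c : R) :
  pv_exists f x -> 0 <= c -> p <= q -> q < x -> (forall y, f y <= 0) ->
  (forall y, y \in `[p, q] -> f y <= - c) ->
  (pv_integral f x <= (- (c * (q - p)))%:E)%E.
Proof.
move=> ex c0 pq qx f0 fc; rewrite /pv_integral; case: asboolP => [_|nint].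
  exact: integral_le_neg.
case: ex => // cv; apply: lime_le => //.
rewrite near_withinE; exists (x - q) => /=; first by rewrite subr_gt0.
move=> e /=; rewrite sub0r normrN => /ltr_normlW eqx e0.
apply: integral_le_neg => // y; rewrite /= in_itv/= => /andP[py yq].
have yx : y < x by exact: le_lt_trans qx.
by rewrite ltr0_norm ?subr_lt0// opprB; lra.
Qed.

Lemma Rintegral_indic_itv (p q : R) : p <= q ->
  (\int[mu]_s (\1_(`[p, q]%classic) s) = q - p)%R.
Proof.
move=> pq; rewrite /Rintegral.
rewrite (@integral_indic _ (measurableTypeR R) R mu setT measurableT)//.
rewrite setIT [X in fine X](lebesgue_measure_itv `[p, q]%R)/= lte_fin lt_neqAle pq andbT.
by case: eqVneq => [->|_] /=; rewrite ?subrr.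
Qed.

End nonpositive_integral.

(** * The kernel *)

Section quasinonlocal.
Set Implicit Arguments. Unset Strict Implicit. Unset Printing Implicit Defensive.
Context {R : realType}.
Local Notation mu := (@lebesgue_measure R).
Context (gamma : R -> R)
  (gamma_ge0 : forall r : R, 0 <= r -> 0 <= gamma r)
  (gamma_noninc : forall r s : R, 0 < r -> r <= s -> s < 1 -> gamma s <= gamma r)
  (gamma_supp : forall r : R, 1 < r -> gamma r = 0)
  (gamma_moment : (\int[mu]_s (`|s| ^+ 2 * gamma `|s|)%:E = 1)%E).

(** A monotone function is measurable, its superlevel sets being intervals; here
    monotonicity is only known on the open unit interval. *)
Lemma measurable_gamma_itv : measurable_fun (`]0, 1[%classic : set R) gamma.
Proof.
apply: (measurability (@RGenCInfty.G R)) => [|/= _ [_] [r] -> <-].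
  exact: RGenCInfty.measurableE.
apply: is_interval_measurable => s t /= [] + + [] + + x /andP[sx xt].
rewrite !in_itv/= !andbT => /andP[s0 s1] rs /andP[t0 t1] rt; split.
  by rewrite (lt_le_trans s0)//= (le_lt_trans xt).
rewrite (le_trans rt)// gamma_noninc//; exact: lt_le_trans sx.
Qed.

(** The values at [0] and [1] escape monotonicity, so they are split off. *)
Lemma measurable_gamma_norm : measurable_fun [set: R] (fun s => gamma `|s|).
Proof.
pose k (r : R) := (gamma \_ `]0, 1[) r
  + gamma 0 * \1_[set 0 : R] r + gamma 1 * \1_[set 1 : R] r.
have mk : measurable_fun [set: R] k.
  apply: measurable_funD; first apply: measurable_funD.
  - by apply/(measurable_restrictT _ _).1 => //; exact: measurable_gamma_itv.
  - by apply: measurable_funM.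
  - by apply: measurable_funM.
rewrite (_ : (fun s => _) = k \o Num.norm); last first.
  apply/funext => s /=; rewrite /k !indicE patchE !in_set1 mem_setE in_itv/=.
  have := normr_ge0 s; move: `|s| => r; rewrite le_eqVlt => /predU1P[<-|r0].
    by rewrite ltxx eqxx eq_sym oner_eq0 mulr1 mulr0 add0r addr0.
  rewrite r0 (gt_eqF r0) mulr0 addr0/=; case: ltgtP => [r1|r1|->].
  - by rewrite mulr0 addr0.
  - by rewrite gamma_supp// mulr0 addr0.
  - by rewrite mulr1 add0r.
exact: measurableT_comp.
Qed.

(** Otherwise the second moment would vanish. *)
Lemma gamma_gt0_near0 : exists2 a, 0 < a < 1 & 0 < gamma a.
Proof.
apply/not_exists2P => gamma0.
have {}gamma0 r : 0 < r -> r != 1 -> gamma r = 0.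
  move=> r0 r1; have [lt1|gt1|/eqP] := ltgtP r 1; last by rewrite (negbTE r1).
    have [] := gamma0 r; first by rewrite r0 lt1.
    by move=> /negP; rewrite lt_neqAle gamma_ge0 ?(ltW r0)// andbT negbK => /eqP.
  exact: gamma_supp.
move: gamma_moment; rewrite (ae_eq_integral (cst 0%E))//.
- by rewrite integral0 => -[] /eqP; rewrite eq_sym oner_eq0.
- apply/measurable_EFinP; apply: measurable_funM; last exact: measurable_gamma_norm.
  by apply: measurable_funX; exact: normr_measurable.
- exists [set 1; -1]; split.
  + by apply: measurableU.
  + by apply: countable_lebesgue_measure0; apply: finite_set_countable.
  move=> s /= /not_implyP[_]; have [s1|s1] := eqVneq `|s| 1.
    by move=> _; move/eqP: s1; rewrite eqr_norml ler01 andbT => /orP[]/eqP ->; [left|right].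
  have [->|s0] := eqVneq s 0; first by rewrite normr0 expr0n mul0r.
  by rewrite gamma0 ?normr_gt0// mulr0.
Qed.

Context (delta : R) (delta_gt0 : 0 < delta) (delta_lt1 : delta < 1).
Local Notation kappa := (scaled_kernel delta gamma).
Local Notation w := (weight delta gamma).

Lemma scaled_kernel_ge0 s : 0 <= scaled_kernel delta gamma s.
Proof.
by rewrite mulr_ge0 ?invr_ge0 ?exprn_ge0 ?gamma_ge0 ?divr_ge0// ltW.
Qed.

Lemma scaled_kernel_eq0 s : delta < `|s| -> scaled_kernel delta gamma s = 0.
Proof.
by move=> ds; rewrite /scaled_kernel gamma_supp ?mulr0// ltr_pdivlMr ?mul1r.
Qed.

Lemma scaled_kernel_gt0_near0 : exists r k : R,
  [/\ 0 < r, r < delta, 0 < k &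
      forall s, 0 < `|s| -> `|s| <= r -> k <= scaled_kernel delta gamma s].
Proof.
have [a /andP[a0 a1] ga] := gamma_gt0_near0.
have d3 : 0 < delta ^- 3 by rewrite invr_gt0 exprn_gt0.
exists (a * delta), (delta ^- 3 * gamma a); split.
- by rewrite mulr_gt0.
- by rewrite -[ltRHS]mul1r ltr_pM2r.
- by rewrite mulr_gt0.
move=> s s0 sa; rewrite ler_pM2l// gamma_noninc ?divr_gt0//.
by rewrite ler_pdivrMr.
Qed.

Lemma measurable_scaled_kernel :
  measurable_fun [set: R] (scaled_kernel delta gamma).
Proof.
apply: measurable_funM => //.
rewrite (_ : (fun s => _) = (fun s => gamma `|s|) \o (fun s => `|s| / delta)).
  apply: measurableT_comp; first exact: measurable_gamma_norm.
  by apply: measurable_funM => //; exact: measurableT_comp.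
apply/funext => s /=; congr gamma.
by rewrite [RHS]ger0_norm// divr_ge0// ltW.
Qed.

#[local] Hint Resolve measurable_scaled_kernel : core.

(** * The weight as an integral over the kernel *)

(** No change of variables is needed: since [delta < 1], one has
    [gamma (|s| / delta) <= gamma |s|] by monotonicity when [0 < |s| < delta], and
    the unscaled second moment is finite by assumption. The point [|s| = delta],
    where [gamma 1] may be large, is absorbed by an indicator function. *)
Lemma integrable_second_moment :
  mu.-integrable setT (EFin \o (fun s => `|s| ^+ 2 * kappa s)).
Proof.
have d3 : 0 < delta ^- 3 by rewrite invr_gt0 exprn_gt0.
have i1 : mu.-integrable setT (EFin \o (fun s => `|s| ^+ 2 * gamma `|s|)).
  apply/integrableP; split.
    apply/measurable_EFinP; apply: measurable_funM.
      by apply: measurable_funX; exact: normr_measurable.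
    exact: measurable_gamma_norm.
  apply: (@le_lt_trans _ _ 1%E); last exact: ltry.
  rewrite -gamma_moment le_eqVlt; apply/orP; left; apply/eqP.
  by apply: eq_integral => s _; rewrite /= ger0_norm// mulr_ge0 ?gamma_ge0 ?exprn_ge0.
pose h s := delta ^- 3 * (`|s| ^+ 2 * gamma `|s|)
          + (delta ^- 3 * (delta ^+ 2 * gamma 1)) * \1_(`[- delta, delta]%classic) s.
have ih : mu.-integrable setT (EFin \o h).
  have -> : EFin \o h = (fun s => (delta ^- 3)%:E * (`|s| ^+ 2 * gamma `|s|)%:E)%E \+
     (fun s => (delta ^- 3 * (delta ^+ 2 * gamma 1))%:E
               * (\1_(`[- delta, delta]%classic) s)%:E)%E.
    by apply/funext => s; rewrite /= -!EFinM -EFinD.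
  apply: integrableD => //; apply: integrableZl => //.
  exact: integrable_indic_itv.
apply: le_integrable ih => //.
  apply/measurable_EFinP; apply: measurable_funM => //.
  by apply: measurable_funX; exact: normr_measurable.
move=> s _ /=; have s2 : 0 <= `|s| ^+ 2 by rewrite exprn_ge0.
have g1 : 0 <= gamma 1 by exact: gamma_ge0.
have d2 : 0 <= delta ^+ 2 by rewrite exprn_ge0 ?ltW.
have gs : 0 <= gamma `|s| by exact: gamma_ge0.
have h1 : 0 <= delta ^- 3 * (`|s| ^+ 2 * gamma `|s|).
  by apply: mulr_ge0; [exact: ltW|exact: mulr_ge0].
have h2 : 0 <= (delta ^- 3 * (delta ^+ 2 * gamma 1)) * \1_(`[- delta, delta]%classic) s.
  by apply: mulr_ge0; rewrite ?indicE//; apply: mulr_ge0; [exact: ltW|exact: mulr_ge0].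
rewrite lee_fin ger0_norm; last by rewrite mulr_ge0// scaled_kernel_ge0.
rewrite [leRHS]ger0_norm; last exact: addr_ge0.
rewrite /h /scaled_kernel mulrCA.
have [s0|] := leP `|s| 0.
  have -> : `|s| = 0 by apply/le_anti; rewrite s0/=.
  by rewrite !(expr0n, mul0r, mulr0)/= add0r.
move=> s0; have [sd|sd|sd] := ltgtP `|s| delta.
- rewrite -[leLHS]addr0 lerD// ler_pM2l// ler_wpM2l// gamma_noninc//.
    by rewrite ler_pdivlMr// ger_pMr// ltW.
  by rewrite ltr_pdivrMr// mul1r.
- rewrite gamma_supp ?mulr0 ?addr_ge0//.
  by rewrite ltr_pdivlMr// mul1r.
- rewrite sd divff ?gt_eqF// indicE mem_set ?mulr1; last first.
    by rewrite /= in_itv/= -ler_norml sd.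
  by rewrite sd in h1; rewrite -[leLHS]add0r lerD2r.
Qed.

(** The inner integral in the weight runs over [|s| t < x], so that [s] is counted
    for a proportion [min(1, x / |s|)] of the [t] in the unit interval. The factor
    [|s|^2] turns this into [|s| min(|s|, x)], which involves no division. *)
Definition weight_density (x s : R) : R := kappa s * (`|s| * Num.min `|s| x).

Lemma measurable_weight_density x : measurable_fun setT (weight_density x).
Proof.
apply: measurable_funM => //; apply: measurable_funM; first exact: normr_measurable.
by apply: measurable_minr => //; exact: normr_measurable.
Qed.

Lemma weight_density_ge0 x s : 0 <= x -> 0 <= weight_density x s.
Proof.
by move=> x0; rewrite mulr_ge0// ?scaled_kernel_ge0// mulr_ge0// le_min normr_ge0.
Qed.

Lemma weight_density_le x s : weight_density x s <= `|s| ^+ 2 * kappa s.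
Proof.
rewrite /weight_density mulrC ler_wpM2r ?scaled_kernel_ge0// expr2 ler_wpM2l//.
by rewrite ge_min lexx.
Qed.

Lemma integrable_weight_density x : 0 <= x ->
  mu.-integrable setT (EFin \o weight_density x).
Proof.
move=> x0; apply: le_integrable integrable_second_moment => //.
  by apply/measurable_EFinP; exact: measurable_weight_density.
move=> s _ /=; rewrite lee_fin [leLHS]ger0_norm ?weight_density_ge0//.
rewrite [leRHS]ger0_norm ?weight_density_le//.
by rewrite mulr_ge0 ?scaled_kernel_ge0// exprn_ge0.
Qed.

(** Tonelli, exchanging the integrations over [t] and [s]. *)
Lemma weight_fubini x : 0 < x ->
  weight delta gamma x = \int[mu]_s weight_density x s.
Proof.
move=> x0; congr fine.
pose A := [set z : R * R | 0 < z.1 < 1] `&` [set z : R * R | `|z.2| * z.1 < x].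
have mA : measurable A.
  apply: measurableI.
    rewrite (_ : [set _ | _] = setT `&` fst @^-1` `]0, 1[%classic); last first.
      by rewrite setTI; apply/seteqP; split=> z /=; rewrite in_itv.
    exact: measurable_fst.
  pose f (z : R * R) := `|z.2| * z.1.
  have mf : measurable_fun setT f.
    apply: measurable_funM; last exact: measurable_fst.
    by apply: measurableT_comp; [exact: normr_measurable|exact: measurable_snd].
  rewrite (_ : [set _ | _] = setT `&` f @^-1` `]-oo, x[%classic).
    exact: mf.
  by rewrite setTI; apply/seteqP; split=> z /=; rewrite in_itv.
pose F (z : R * R) := (`|z.2| ^+ 2 * kappa z.2 * \1_A z)%:E.
have mF : measurable_fun setT F.
  apply/measurable_EFinP; apply: measurable_funM => //.
  have mg : measurable_fun [set: R] (fun s => `|s| ^+ 2 * kappa s).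
    apply: measurable_funM => //.
    by apply: measurable_funX; exact: normr_measurable.
  exact: (measurableT_comp mg measurable_snd).
have F0 z : (0 <= F z)%E.
  rewrite lee_fin; apply: mulr_ge0; rewrite ?indicE//.
  by apply: mulr_ge0; rewrite ?exprn_ge0 ?scaled_kernel_ge0.
transitivity (\int[mu]_t \int[mu]_s F (t, s))%E.
  rewrite integral_mkcond; apply: eq_integral => t _.
  rewrite patchE mem_setE in_itv/=; case: ifPn => t01; last first.
    rewrite integral0_eq// => s _; rewrite /F indicE memNset ?mulr0//.
    by move=> -[/= t01' _]; rewrite t01' in t01.
  rewrite integral_mkcond; apply: eq_integral => s _.
  rewrite patchE /F indicE; have /andP[t0 t1] := t01.
  case: ifPn; rewrite ?inE ?notin_setE/= ltr_pdivlMr// => sx.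
    by rewrite mem_set ?mulr1//; split.
  by rewrite memNset ?mulr0//= => -[].
rewrite (fubini_tonelli (m1 := mu) (m2 := mu) F)//.
apply: eq_integral => s _.
(* At [s = 0] the section in [t] is the whole unit interval, and the factor
   [|s|^2] vanishes. *)
have [->|s0] := eqVneq s 0.
  rewrite integral0_eq => [|t _].
    by rewrite /weight_density normr0 mul0r mulr0.
  by rewrite /F/= normr0 expr0n !mul0r.
have {}s0 : 0 < `|s| by rewrite normr_gt0.
pose m := Num.min 1 (x / `|s|).
have m0 : 0 < m by rewrite lt_min ltr01 divr_gt0.
have c0 : 0 <= `|s| ^+ 2 * kappa s by rewrite mulr_ge0 ?exprn_ge0 ?scaled_kernel_ge0.
transitivity (\int[mu]_t (`|s| ^+ 2 * kappa s * \1_(`]0%R, m[%classic) t)%:E)%E.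
  apply: eq_integral => t _; rewrite /F !indicE; congr ((_ * _%:R)%:E).
  congr nat_of_bool.
  apply/idP/idP; rewrite !inE/= in_itv/= lt_min ltr_pdivlMr// [t * _]mulrC.
    by move=> [/= /andP[-> ->] ->].
  by move=> /and3P[t0 t1 tx]; split; rewrite //= t0.
rewrite (@integralZl_indic _ (measurableTypeR R) R mu setT measurableT
  (fun=> [set` `]0, m[%R]))//; last by move=> /lt_geF; rewrite c0.
rewrite integral_indic// setIT [X in (_ * X)%E](lebesgue_measure_itv `]0, m[%R)/=.
rewrite lte_fin m0 oppr0 adde0 -EFinM; congr EFin.
have -> : weight_density x s = kappa s * (`|s| * (`|s| * m)).
  by rewrite /m minr_pMr// mulr1 [X in Num.min _ X]mulrC divfK// gt_eqF.
ring.
Qed.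

(** The density is bounded below on [r / 2, r] when the kernel is bounded below
    on [(0, r]. *)
Lemma weight_gt0 x : 0 < x -> 0 < weight delta gamma x.
Proof.
move=> x0; rewrite weight_fubini//.
have [r [k [r0 rd k0 kr]]] := scaled_kernel_gt0_near0.
pose c := k * (r / 2 * Num.min (r / 2) x).
have r20 : 0 < r / 2 by rewrite divr_gt0.
have c0 : 0 < c by rewrite !mulr_gt0// lt_min r20.
have r2r : r / 2 <= r by lra.
apply: (@lt_le_trans _ _ (\int[mu]_s (c * \1_(`[r / 2, r]%classic) s))).
  rewrite RintegralZl//; last exact: integrable_indic_itv.
  by rewrite Rintegral_indic_itv// mulr_gt0// subr_gt0; lra.
apply: le_Rintegral => //.
- rewrite (_ : EFin \o _ = (fun s => c%:E * (\1_(`[r / 2, r]%classic) s)%:E)%E).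
    by apply: integrableZl => //; exact: integrable_indic_itv.
  by apply/funext => s; rewrite /= EFinM.
- exact/integrable_weight_density/ltW.
move=> s _; rewrite indicE; case: (boolP (s \in _)); last first.
  by rewrite mulr0 weight_density_ge0// ltW.
rewrite inE/= in_itv/= => /andP[rs sr].
have s0 : 0 < s by lra.
rewrite mulr1 /weight_density gtr0_norm//.
have mr : 0 < Num.min (r / 2) x by rewrite lt_min r20.
apply: ler_pM; [exact: ltW|by rewrite ltW ?mulr_gt0| |].
  by apply: kr; rewrite gtr0_norm.
apply: ler_pM; [exact: ltW|exact: ltW|exact: rs|].
by rewrite le_min !ge_min rs lexx orbT.
Qed.

(** Dominated convergence, with the second moment of the kernel as dominating
    function. *)
Lemma weight_cvg0 : weight delta gamma n.+1%:R^-1 @[n --> \oo] --> (0 : R).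
Proof.
pose g (s : R) : \bar R := (`|s| ^+ 2 * kappa s)%:E.
have n0 n : 0 < n.+1%:R^-1 :> R by rewrite invr_gt0.
have [| | | | |_ _] := @dominated_convergence _ (measurableTypeR R) R mu setT measurableT
  (fun n s => (weight_density n.+1%:R^-1 s)%:E) (cst 0%E) g.
- move=> n; apply/measurable_EFinP.
  exact: measurable_weight_density.
- exact: measurable_cst.
- apply: aeW => s _; apply: cvg_EFin; first exact: nearW.
  rewrite [X in _ --> X](_ : _ = kappa s * (`|s| * 0)); last by rewrite !mulr0.
  apply: cvgMr; apply: cvgMr.
  apply: (@squeeze_cvgr _ _ _ _ (cst 0) (@harmonic R)).
  - by apply: nearW => n; rewrite le_min normr_ge0 ltW//= ge_min lexx orbT.
  - exact: cvg_cst.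
  - exact: cvg_harmonic.
- exact: integrable_second_moment.
- apply: aeW => s n _; rewrite /g /= lee_fin ger0_norm.
    exact: weight_density_le.
  by apply: weight_density_ge0 => //; exact: ltW.
rewrite integral0 => /fine_cvg; apply: cvg_trans.
rewrite (_ : (fun n => _) =
    fine \o [sequence \int[mu]_s (weight_density n.+1%:R^-1 s)%:E]_n)%E//.
by apply/funext => n /=; rewrite weight_fubini.
Qed.

(** Differentiating under the integral gives the integral of [kappa(s) |s|] over
    [|s| > x]. By [min_increment] the error only comes from [s] with [|s|] within
    [|h|] of [x]; the kernel is bounded there, away from [0], so
    the error is quadratic in [h]. *)
Lemma derivable_weight x : 0 < x -> x < delta ->
  derivable (weight delta gamma) x 1.
Proof.
move=> x0 xd.
pose D (s : R) := kappa s * (`|s| * \1_[set s : R | x < `|s|] s).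
pose B := delta * (delta ^- 3 * gamma (x / 2 / delta)).
have B0 : 0 <= B.
  by rewrite !mulr_ge0 ?invr_ge0 ?exprn_ge0 ?gamma_ge0 ?divr_ge0 ?ltW ?divr_gt0.
have mD : measurable_fun setT D.
  apply: measurable_funM => //; apply: measurable_funM; first exact: normr_measurable.
  apply: measurable_indic.
  rewrite (_ : [set s : R | _] = setT `&` Num.norm @^-1` `]x, +oo[%classic).
    exact: normr_measurable.
  by rewrite setTI; apply/seteqP; split=> z /=; rewrite in_itv/= andbT.
have iD : mu.-integrable setT (EFin \o D).
  have ig : mu.-integrable setT (EFin \o (fun s => x^-1 * (`|s| ^+ 2 * kappa s))).
    rewrite (_ : EFin \o _ = (fun s => x^-1%:E * (`|s| ^+ 2 * kappa s)%:E)%E).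
      apply: integrableZl => //; exact: integrable_second_moment.
    by apply/funext => s; rewrite /= EFinM.
  apply: le_integrable ig => //; first exact/measurable_EFinP.
  move=> s _ /=; rewrite lee_fin [leLHS]ger0_norm; last first.
    by rewrite mulr_ge0 ?scaled_kernel_ge0// mulr_ge0// indicE.
  rewrite [leRHS]ger0_norm; last first.
    apply: mulr_ge0; first by rewrite invr_ge0 ltW.
    by rewrite mulr_ge0 ?exprn_ge0 ?scaled_kernel_ge0.
  have -> : x^-1 * (`|s| ^+ 2 * kappa s) = kappa s * (`|s| * (x^-1 * `|s|)) by ring.
  rewrite ler_wpM2l ?scaled_kernel_ge0// ler_wpM2l//.
  rewrite indicE; case: (boolP (s \in _)); rewrite ?inE ?notin_setE /= => sx.
    by rewrite mulrC ler_pdivlMr// mul1r ltW.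
  by rewrite mulr_ge0 ?invr_ge0// ltW.
(* The constraints on [h] keep [|s|] between [x / 2] and [delta], where
   [kappa s * |s|] is at most [B]. *)
have bound h : `|h| < x / 2 -> `|h| < delta - x ->
    `|weight delta gamma (x + h) - weight delta gamma x
      - h * \int[mu]_s D s| <= 4 * B * `|h| ^+ 2.
  move=> hx hd; have xh0 : 0 < x + h by move: hx; rewrite ltr_norml => /andP[]; lra.
  have h0 : 0 <= `|h| by [].
  pose I1 := `[x - `|h|, x + `|h|]%classic.
  pose I2 := `[- x - `|h|, - x + `|h|]%classic.
  pose J (s : R) : R := \1_I1 s + \1_I2 s.
  have iI : mu.-integrable setT (EFin \o J).
    rewrite (_ : EFin \o _ = (fun s => (\1_I1 s)%:E) \+ (fun s => (\1_I2 s)%:E))%E.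
      by apply: integrableD => //; exact: integrable_indic_itv.
    by apply/funext => s; rewrite /= EFinD.
  have iB : mu.-integrable setT (EFin \o (fun s => B * `|h| * J s)).
    rewrite (_ : EFin \o _ = (fun s => (B * `|h|)%:E * (J s)%:E)%E).
      exact: integrableZl.
    by apply/funext => s; rewrite /= EFinM.
  have ihD : mu.-integrable setT (EFin \o (fun s => h * D s)).
    rewrite (_ : EFin \o _ = (fun s => h%:E * (D s)%:E)%E).
      exact: integrableZl.
    by apply/funext => s; rewrite /= EFinM.
  have i1 := integrable_weight_density (ltW xh0).
  have i2 := integrable_weight_density (ltW x0).
  have i12 : mu.-integrable setT
      (EFin \o (fun s => weight_density (x + h) s - weight_density x s)).
    rewrite (_ : EFin \o _ = (EFin \o weight_density (x + h))
                           \- (EFin \o weight_density x))%E.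
      exact: integrableB.
    by apply/funext => s; rewrite /= EFinB.
  rewrite !weight_fubini// -RintegralB// -RintegralZl// -RintegralB//.
  have i123 : mu.-integrable setT
      (EFin \o (fun s => weight_density (x + h) s - weight_density x s - h * D s)).
    rewrite (_ : EFin \o _ =
      (EFin \o (fun s => weight_density (x + h) s - weight_density x s)%R)
                           \- (EFin \o (fun s => h * D s)%R))%E.
      exact: integrableB.
    by apply/funext => s; rewrite /= -EFinB.
  apply: le_trans (le_normr_Rintegral _ _) _ => //.
  apply: (@le_trans _ _ (\int[mu]_s (B * `|h| * J s))).
    apply: le_Rintegral => //.
      exact: integrable_norm.
    move=> s _.
    have -> : weight_density (x + h) s - weight_density x s - h * D s =
       kappa s * `|s| * (Num.min `|s| (x + h) - Num.min `|s| x - h * (x < `|s|)%R%:R).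
      by rewrite /D /weight_density indicE mem_setE; ring.
    have ks : 0 <= kappa s * `|s| by apply: mulr_ge0; rewrite ?scaled_kernel_ge0.
    rewrite normrM (ger0_norm ks).
    apply: le_trans (ler_wpM2l ks (min_increment _ _ _)) _.
    have [sx|sx] := leP `| `|s| - x| `|h|; last first.
      rewrite !mulr0; apply: mulr_ge0; first exact: mulr_ge0.
      by rewrite /J !indicE addr_ge0.
    rewrite mulr1; move: sx; rewrite ler_norml => /andP[sx1 sx2].
    have J1 : 1 <= J s.
      rewrite /J !indicE; have [s0|s0] := leP 0 s.
        have -> : s \in I1.
          move: sx1 sx2; rewrite inE /I1/= in_itv/= (ger0_norm s0) => sx1 sx2.
          by apply/andP; split; lra.
        by rewrite lerDl.
      have -> : s \in I2.
        move: sx1 sx2; rewrite inE /I2/= in_itv/= (ltr0_norm s0) => sx1 sx2.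
        by apply/andP; split; lra.
      by rewrite lerDr.
    have sd : `|s| < delta by lra.
    have sx : x / 2 <= `|s| by lra.
    have kB : kappa s * `|s| <= B.
      rewrite mulrC; apply: ler_pM; [by []|exact: scaled_kernel_ge0|exact: ltW|].
      rewrite ler_wpM2l ?invr_ge0 ?exprn_ge0 ?(ltW delta_gt0)// gamma_noninc//.
      - by rewrite !divr_gt0.
      - by rewrite ler_pM2r ?invr_gt0.
      - by rewrite ltr_pdivrMr// mul1r.
    apply: (@le_trans _ _ (B * `|h|)); first exact: ler_wpM2r.
    by rewrite ler_peMr// mulr_ge0.
  have -> : \int[mu]_s (B * `|h| * J s) = B * `|h| * \int[mu]_s J s.
    exact: RintegralZl.
  have -> : \int[mu]_s J s = \int[mu]_s \1_I1 s + \int[mu]_s \1_I2 s.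
    by apply: RintegralD => //; exact: integrable_indic_itv.
  rewrite !Rintegral_indic_itv; [|lra..].
  by rewrite le_eqVlt; apply/orP; left; apply/eqP; ring.
apply/cvg_ex; exists (\int[mu]_s D s).
apply/cvgrPdist_lt => e e0; rewrite near_withinE.
have B1 : 0 < 4 * B + 1 by lra.
exists (Num.min (Num.min (x / 2) (delta - x)) (e / (4 * B + 1))) => /=.
  by rewrite !lt_min subr_gt0 xd !divr_gt0.
move=> h /=; rewrite sub0r normrN !lt_min => /andP[/andP[hx hd] he] h0.
have hpos : 0 < `|h| by rewrite normr_gt0.
have -> : \int[mu]_s D s - h^-1 *: (weight delta gamma (h *: 1 + x) - weight delta gamma x)
    = - (h^-1 * (weight delta gamma (x + h) - weight delta gamma x - h * \int[mu]_s D s)).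
  by rewrite mulrBr mulKf// opprB /GRing.scale/= mulr1 (addrC h x).
rewrite normrN normrM normfV ltr_pdivrMl//.
apply: le_lt_trans (bound h hx hd) _.
rewrite expr2 mulrA mulrC ltr_pM2l//.
move: he; rewrite ltr_pdivlMr//; apply: le_lt_trans.
by rewrite mulrC ler_wpM2l// lerDl.
Qed.

(** * The nonlocal side: maxima attained on the left *)

Lemma jump_integrand_le0 (u : R -> R) x y :
  (`|y - x| <= delta -> u y <= u x) -> jump_integrand delta gamma u x y <= 0.
Proof.
move=> uyx; have [yx|yx] := leP `|y - x| delta.
  by rewrite mulr_ge0_le0 ?subr_le0 ?uyx//; exact: scaled_kernel_ge0.
by rewrite /jump_integrand scaled_kernel_eq0 ?mul0r// normr_id.
Qed.

(** At a maximum point over the range of the kernel the integrand is nonpositive.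
    Just to the left of it [u] is smaller, and by continuity smaller by a fixed
    amount on a whole interval, where the kernel is bounded below. *)
Lemma pv_integral_first_max_lt0 (u : R -> R) (a b x : R) :
  a < x -> x <= b -> {within `[a, b], continuous u} ->
  (forall y, `|y - x| <= delta -> u y <= u x) ->
  (forall y, y \in `[a, b] -> y < x -> u y < u x) ->
  pv_exists (jump_integrand delta gamma u x) x ->
  (pv_integral (jump_integrand delta gamma u x) x < 0)%E.
Proof.
move=> ax xb cu ux ultx ex.
have [r [k [r0 rd k0 kr]]] := scaled_kernel_gt0_near0.
(* Left of [x], but within the domain and within reach of the kernel. *)
pose l := Num.max a (x - r).
have lx : l < x by rewrite gt_max ax/= ltrBlDr ltrDl.
have al : a <= l by rewrite le_max lexx.
have rl : x - r <= l by rewrite le_max lexx orbT.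
pose p := (l + x) / 2.
have lp : l < p by rewrite midf_lt.
have px : p < x by rewrite midf_lt.
have pab : p \in `[a, b] by rewrite in_itv/=; apply/andP; split; lra.
(* Half of the gap at [p], the other half being lost by continuity. *)
pose e := (u x - u p) / 2.
have e0 : 0 < e by rewrite divr_gt0// subr_gt0 ultx.
have [d d0 ud] := within_continuousP cu pab e0.
pose q := Num.min (p + d / 2) ((p + x) / 2).
have pq : p < q by rewrite lt_min ltrDl divr_gt0//= midf_lt.
have qd : q <= p + d / 2 by rewrite ge_min lexx.
have qx : q < x by rewrite gt_min midf_lt// orbT.
apply: (@le_lt_trans _ _ (- ((k * e) * (q - p)))%:E); last first.
  by rewrite lte_fin oppr_lt0 mulr_gt0 ?subr_gt0// mulr_gt0.
apply: pv_integral_le_neg => //.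
- by rewrite mulr_ge0 ?ltW.
- exact: ltW.
- by move=> y; apply: jump_integrand_le0; exact: ux.
move=> y; rewrite in_itv/= => /andP[py yq].
have yx : y < x by exact: le_lt_trans qx.
have yab : y \in `[a, b] by rewrite in_itv/=; apply/andP; split; lra.
have uy : u y - u x <= - e.
  have : `|u p - u y| < e.
    by apply: ud => //; rewrite distrC ger0_norm ?subr_ge0//; lra.
  rewrite distrC => /ltr_normlW; rewrite /e; lra.
have kyx : k <= scaled_kernel delta gamma `|y - x|.
  by apply: kr; rewrite normr_id ltr0_norm ?subr_lt0// ?opprB; lra.
rewrite /jump_integrand -mulrN.
apply: (@le_trans _ _ (scaled_kernel delta gamma `|y - x| * - e)).
  by rewrite ler_wpM2l// (le_trans _ kyx)// ltW.
by rewrite !mulrN lerN2 ler_pM2r.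
Qed.

(** * The local side: maxima approached from the right of the interface *)

(** Where [u x] dominates the values on the left within reach, the integral term
    of the equation is nonpositive, possibly infinite, and so the local term has
    to be nonnegative. *)
Lemma flux_derive_ge0 (u : R -> R) x : 0 < x -> x <= delta ->
  (forall y : R, y < 0 -> `|y - x| <= delta -> u y <= u x) ->
  (- Lqnl delta gamma u x <= 0)%E ->
  0 <= derive1 (fun z => w z * derive1 u z) x.
Proof.
move=> x0 xd ux; rewrite oppe_le0 /Lqnl (lt_geF x0) xd => L0.
rewrite -lee_fin; apply: (le_trans L0); rewrite geeDr// mule_ge0_le0//.
(* With [c = 0] the bound is [0], whatever the interval; [-1, -1] is one to the
   left of [0]. *)
apply: le_trans (@integral_le_neg _ _ _ (-1) (-1) 0 _ _ _ _ _) _ => //.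
- by move=> y /=; rewrite in_itv/= => y0; apply: jump_integrand_le0 => //; exact: ux.
- by move=> y /=; rewrite !in_itv/= => /andP[_ y1]; lra.
- move=> y; rewrite in_itv/= => /andP[_ y1]; rewrite oppr0.
  by apply: jump_integrand_le0 => //; apply: ux; lra.
Qed.

Context (u v v' v'' : R -> R)
  (dv : is_derivative_on `[0, 1] v v') (dv' : is_derivative_on `[0, 1] v' v'')
  (uv : forall x : R, 0 < x -> x <= 1 -> u x = v x).

Lemma derivable_flux x :
  0 < x -> x < delta -> derivable (fun z => w z * derive1 u z) x 1.
Proof.
move=> x0 xd; apply: derivableM.
  exact: derivable_weight.
by have [] := C2_on_interior dv dv' uv (x := x); rewrite ?in_itv/= ?x0 ?(lt_trans xd).
Qed.

(** The flux is nondecreasing, so its value at [x] is at least its values at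
    points tending to [0]; these are small because the weight tends to [0] and
    [u'] is bounded. *)
Lemma flux_ge0_at0 b :
  b <= delta ->
  (forall x : R, x \in `]0, b[ -> 0 <= derive1 (fun z => w z * derive1 u z) x) ->
  forall x : R, x \in `]0, b[ -> 0 <= w x * derive1 u x.
Proof.
move=> bd F0 x; rewrite in_itv/= => /andP[x0 xb].
have dF (z : R) : z \in `]0, b[ -> derivable (fun z => w z * derive1 u z) z 1.
  rewrite in_itv/= => /andP[z0 zb].
  by apply: derivable_flux => //; exact: lt_le_trans bd.
have Fmono := derive1_ge0_homo dF F0.
have [d d0 v'd] := within_continuousP (is_derivative_on_continuous dv')
  (x := 0) ltac:(by rewrite in_itv/= lexx ler01) ltr01.
pose C := 1 + `|v' 0|; have C0 : 0 < C by rewrite ltr_pwDl.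
rewrite leNgt; apply/negP => Fx.
pose e := - (w x * derive1 u x) / C.
have e0 : 0 < e by rewrite divr_gt0// oppr_gt0.
have x1 : x < 1 by rewrite (lt_trans xb)// (le_lt_trans bd).
pose r := Num.min x d; have r0 : 0 < r by rewrite lt_min x0.
have := near_infty_natSinv_lt (PosNum r0).
have /cvgrPdist_lt/(_ e e0) := weight_cvg0.
move=> h1 h2; near \oo => n.
have y0 : 0 < n.+1%:R^-1 :> R by rewrite invr_gt0.
have wy : `|0 - w n.+1%:R^-1| < e by near: n.
have yr : n.+1%:R^-1 < r by near: n.
move: y0 wy yr; move: (n.+1%:R^-1) => y y0.
have wy0 : 0 < w y by exact: weight_gt0.
rewrite sub0r normrN gtr0_norm// => wy; rewrite lt_min => /andP[yx yd].
have := Fmono y x y0 (ltW yx) xb; apply/negP; rewrite -ltNge.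
have [_ _ -> _] := C2_on_interior dv dv' uv (x := y)
  ltac:(by rewrite in_itv/= y0 (lt_trans yx)).
have v'y : `|v' y| < C.
  have := v'd y; rewrite in_itv/= (ltW y0) (ltW (lt_trans yx x1)) sub0r normrN gtr0_norm// => /(_ isT yd).
  rewrite distrC => vy; rewrite /C -[v' y](subrK (v' 0)).
  by apply: le_lt_trans (ler_normD _ _) _; rewrite ltrD2r.
rewrite -ltrN2 -mulrN; apply: (@le_lt_trans _ _ (w y * C)).
  by rewrite ler_pM2l// (le_trans (ler_norm _))// normrN ltW.
by rewrite -ltr_pdivlMr.
Unshelve. all: by end_near. Qed.

Context (Lu_ge0 : forall x, Omega x -> (- Lqnl delta gamma u x <= 0)%E).

(** The interval to the right of [m] is short enough for [v] to stay above [N] and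
    does not cross [delta], where the operator changes. For [m < delta] the
    conclusion comes from the flux, for [delta <= m] from [u'' >= 0]. *)
Lemma derivative_ge0_after_max N m :
  (forall y : R, y \in `[-1 - delta, 0] -> u y <= N) -> N < v m ->
  0 <= m -> m < 1 -> (forall x : R, x \in `[0, 1] -> v x <= v m) ->
  exists b : R, [/\ m < b, b <= 1 & forall x, x \in `]m, b[ -> 0 <= v' x].
Proof.
move=> uN Nm m0 m1 vmax; have v'm : 0 < m -> derive1 u m = 0.
  move=> {}m0; have m01 : m \in `]0, 1[ by rewrite in_itv/= m0.
  have [_ <- -> _] := C2_on_interior dv dv' uv m01; rewrite derive1E.
  case: (@derive1_at_max _ v 0 1 m ler01) => //.
    by move=> t t01; have [] := C2_on_interior dv dv' uv t01.
  by move=> t t01; apply: vmax; exact: subset_itv_oo_cc.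
have [dm|md] := leP delta m.
  exists 1; split=> // x x1.
  have x01 : x \in `]0, 1[.
    by move: x1; rewrite !in_itv/= => /andP[mx ->]; rewrite (le_lt_trans m0).
  have [_ _ <- _] := C2_on_interior dv dv' uv x01.
  apply: (ge0_after (F := derive1 u) _ _ _ x1).
  - move=> z; rewrite in_itv/= => /andP[mz z1].
    have z01 : z \in `]0, 1[ by rewrite in_itv/= z1 (lt_le_trans delta_gt0)// (le_trans dm).
    by have [] := C2_on_interior dv dv' uv z01.
  - move=> z; rewrite in_itv/= => /andP[mz z1].
    have dz : delta < z by exact: le_lt_trans mz.
    have z0 : 0 < z by exact: lt_trans dz.
    have /Lu_ge0 : Omega z by rewrite /Omega/= in_itv/= z1 (lt_trans _ z0).
    by rewrite oppe_le0 /Lqnl (lt_geF z0) (lt_geF dz) lee_fin derive1nS derive1n1.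
  - by rewrite v'm// (lt_le_trans delta_gt0).
have m01 : m \in `[0, 1] by rewrite in_itv/= m0 ltW.
have vmN : 0 < v m - N by rewrite subr_gt0.
have [d d0 vd] := within_continuousP (is_derivative_on_continuous dv) m01 vmN.
pose b : R := Num.min (m + d) delta.
have bd : b <= delta by rewrite ge_min lexx orbT.
have bm : b <= m + d by rewrite ge_min lexx.
have mb : m < b by rewrite lt_min ltrDl d0.
have b1 : b < 1 by exact: le_lt_trans delta_lt1.
clearbody b.
have F0 (x : R) : x \in `]m, b[ -> 0 <= derive1 (fun z => w z * derive1 u z) x.
  rewrite in_itv/= => /andP[mx xb].
  have x0 : 0 < x by exact: le_lt_trans mx.
  have x1 : x < 1 by exact: lt_trans b1.
  apply: (flux_derive_ge0 x0) => //.
  - lra.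
  - move=> y y0; rewrite ler_norml => /andP[yx1 yx2].
    rewrite (uv x0 (ltW x1)); apply: (@le_trans _ _ N).
      by apply: uN; rewrite in_itv/=; apply/andP; split; lra.
    have : `|v m - v x| < v m - N.
      apply: vd; first by rewrite in_itv/= !ltW.
      by rewrite ltr0_norm ?subr_lt0//; lra.
    by move=> /ltr_normlW; lra.
  - by apply: Lu_ge0; rewrite /Omega/= in_itv/=; apply/andP; split; lra.
exists b; split=> //; first exact: ltW.
move=> x xmb; have := xmb; rewrite in_itv/= => /andP[mx xb].
have x0 : 0 < x by exact: le_lt_trans mx.
have x01 : x \in `]0, 1[ by rewrite in_itv/= x0 (lt_trans xb).
(* The sign of [v' x] is that of the flux, the weight being positive. *)
have [_ _ <- _] := C2_on_interior dv dv' uv x01.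
have wx : 0 < w x by exact: weight_gt0.
rewrite -(pmulr_rge0 _ wx).
move: m0; rewrite le_eqVlt => /predU1P[m0|m0].
  rewrite -m0 in F0 xmb.
  exact: flux_ge0_at0 bd F0 _ xmb.
apply: (ge0_after (F := fun z => w z * derive1 u z) _ F0 _ xmb).
  move=> z; rewrite in_itv/= => /andP[mz zb].
  apply: derivable_flux; lra.
by rewrite v'm// mulr0.
Qed.

Lemma last_max_eq1 N m :
  (forall y : R, y \in `[-1 - delta, 0] -> u y <= N) -> N < v m ->
  m \in `[0, 1] -> (forall x : R, x \in `[0, 1] -> v x <= v m) ->
  (forall x : R, x \in `[0, 1] -> m < x -> v x < v m) -> m = 1.
Proof.
move=> uN Nm + vmax vlt; rewrite in_itv/= => /andP[m0].
rewrite le_eqVlt => /predU1P[//|m1].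
have [b [mb b1 v'0]] := derivative_ge0_after_max uN Nm m0 m1 vmax.
pose y : R := (m + b) / 2.
have my : m < y by rewrite midf_lt.
have yb : y < b by rewrite midf_lt.
clearbody y.
have y01 : y \in `[0, 1] by rewrite in_itv/=; apply/andP; split; lra.
have := vlt y y01 my; rewrite ltNge => /negP[].
have sub (z : R) : z \in `]m, y[ -> (z \in `]0, 1[) /\ (z \in `]m, b[).
  by rewrite !in_itv/= => /andP[mz zy]; split; apply/andP; split; lra.
apply: (@ger0_derive1_ndecr _ v m y) => //; last exact: ltW.
- by move=> z /sub[z01 _]; have [] := C2_on_interior dv dv' uv z01.
- move=> z /sub[z01 zmb]; have [_ -> _ _] := C2_on_interior dv dv' uv z01.
  exact: v'0.
- apply: continuous_subspaceW (is_derivative_on_continuous dv) => z /=.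
  by rewrite !in_itv/= => /andP[mz zy]; apply/andP; split; lra.
Qed.

(** A first maximum point inside the domain is excluded by the sign of the
    equation there. *)
Lemma first_max_le_N1 m :
  {within `[-1 - delta, 0], continuous u} ->
  m \in `[-1 - delta, 0] ->
  (forall y : R, y \in `[-1 - delta, 1] -> u y <= u m) ->
  (forall y : R, y \in `[-1 - delta, 0] -> y < m -> u y < u m) ->
  (forall x, Omega x -> Lqnl_defined delta gamma u x) -> m <= -1.
Proof.
have d0 := delta_gt0; have d1 := delta_lt1.
move=> cu + umax ult Lu; rewrite in_itv/= => /andP[m0 m1].
rewrite leNgt; apply/negP => mN1.
have Om : Omega m by rewrite /Omega/= in_itv/= mN1 (le_lt_trans m1).
have := Lu_ge0 Om; rewrite oppe_le0 /Lqnl m1 leNgt; apply/negP; rewrite negbK.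
rewrite mule_gt0_lt0//.
apply: (pv_integral_first_max_lt0 (a := -1 - delta) (b := 0)) => //.
- lra.
- move=> y; rewrite ler_norml => /andP[y1 y2].
  by apply: umax; rewrite in_itv/=; apply/andP; split; lra.
- exact: Lu.
Qed.

End quasinonlocal.

(** * The maximum principle *)

Theorem lemma4p1 (R : realType) (gamma : R -> R)
  (gamma_ge0 : forall r, 0 <= r -> 0 <= gamma r)
  (gamma_noninc : forall r s, 0 < r -> r <= s -> s < 1 -> gamma s <= gamma r)
  (gamma_supp : forall r, 1 < r -> gamma r = 0)
  (gamma_moment :
     (\int[lebesgue_measure]_s (`|s| ^+ 2 * gamma `|s|)%:E = 1)%E)
  (delta : R) (delta_gt0 : 0 < delta) (delta_lt1 : delta < 1)
  (u : R -> R)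
  (u_cont : {within `[-1 - delta, 0], continuous u})
  (u_C2 : exists2 v : R -> R, C2_on `[0, 1] v
                            & forall x, 0 < x -> x <= 1 -> u x = v x)
  (Lu_defined : forall x, Omega x -> Lqnl_defined delta gamma u x)
  (Lu_ge0 : forall x, Omega x -> (- Lqnl delta gamma u x <= 0)%E) :
  (ereal_sup [set (u x)%:E | x in Omega `|` Omega_delta delta]
   <= ereal_sup [set (u x)%:E | x in Omega_delta delta])%E.

Proof.
have [v [v' [v'' [dv dv' _]]] uv] := u_C2.
have ab0 : -1 - delta <= 0 :> R by lra.
have [m1 m1ab [u_le u_lt]] := first_argmax ab0 u_cont.
have [m2 m2ab [v_le v_lt]] := last_argmax ler01 (is_derivative_on_continuous dv).
have u_split x : x \in `[-1 - delta, 1] ->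
    x \in `[-1 - delta, 0] \/ u x = v x /\ (x \in `[0, 1]).
  rewrite !in_itv/= => /andP[xd x1]; have [x0|x0] := leP x 0; [left|right].
    by rewrite xd.
  by split; [exact: uv|rewrite x1 ltW].
have dom x : (Omega `|` Omega_delta delta) x -> x \in `[-1 - delta, 1].
  by move=> [|[|->]]; rewrite /Omega/= ?in_itv/=; [move=> /andP[? ?]|move=> /andP[? ?]|];
    apply/andP; split; lra.
apply: ge_ereal_sup => _ [x /dom xdom <-].
have [vu|uv12] := leP (v m2) (u m1).
  have umax y : y \in `[-1 - delta, 1] -> u y <= u m1.
    by move=> /u_split[/u_le//|[-> /v_le vy]]; exact: le_trans vu.
  have m1N1 : m1 <= -1.
    exact: (first_max_le_N1 gamma_ge0 gamma_noninc gamma_supp gamma_moment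
      delta_gt0 delta_lt1 Lu_ge0 u_cont).
  apply: (@le_trans _ _ (u m1)%:E); first by rewrite lee_fin umax.
  apply: (ereal_sup_ge_closure (c := -1 - delta) (d := -1) _ u_cont) => //.
  - lra.
  - by move=> y yc; left.
  - by move=> y /=; rewrite !in_itv/= => /andP[? ?]; apply/andP; split; lra.
  - by move: m1ab; rewrite !in_itv/= m1N1 => /andP[-> _].
have m21 : m2 = 1.
  exact: (last_max_eq1 gamma_ge0 gamma_noninc gamma_supp gamma_moment
    delta_gt0 delta_lt1 dv dv' uv Lu_ge0 u_le uv12 m2ab v_le v_lt).
apply: (@le_trans _ _ (u 1)%:E); last by apply: ereal_sup_ubound; exists 1 => //; right.
rewrite lee_fin (uv _ ltr01 (lexx 1)) -m21.
case: (u_split x xdom) => [/u_le ux|[-> /v_le//]].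
by rewrite (le_trans ux)// ltW.
Qed.
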